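(* If $\mathcal S$ is a co-meager semifilter on $\omega$, then there is an ultrafilter $\mathcal F$ on $\mathcal S$ whose Stone dual $\hat{\mathcal F}$ is a $2^\omega$-O.K. set (and hence a weak $P$-set) in $\omega^*$.
   Context: For $A,B\subseteq\omega$, $A\subseteq^* B$ means $A\setminus B$ is finite. A semifilter on $\omega$ is a set $\mathcal S\subseteq\mathcal P(\omega)$ with $\emptyset\neq\mathcal S\neq\mathcal P(\omega)$ closed upwards under $\subseteq^*$; subsets of $\omega$ are identified with points of $2^\omega$ and co-meager refers to that topology. A filter on $\mathcal S$ is a nonempty $\mathcal F\subseteq\mathcal S$ closed upwards under $\subseteq^*$ and under finite intersections; an ultrafilter on $\mathcal S$ is a maximal filter on $\mathcal S$. $\omega^*$ is the space of free ultrafilters on $\omega$ with basic open sets $A^*=\{p\in\omega^*:A\in p\}$; the Stone dual of $\mathcal F$ is $\hat{\mathcal F}=\bigcap_{A\in\mathcal F}A^*$. For a cardinal $\kappa$, a closed set $X\subseteq\omega^*$ is $\kappa$-O.K. if for every sequence $\langle U_n:n<\omega\rangle$ of open neighbourhoods of $X$ there is a family $\{V_\gamma:\gamma<\kappa\}$ of neighbourhoods of $X$ such that $\bigcap_{\gamma\in\Gamma}V_\gamma\subseteq U_{|\Gamma|}$ for every finite $\Gamma\subseteq\kappa$. A set $X\subseteq\omega^*$ is a weak $P$-set if the closure of every countable $D\subseteq\omega^*\setminus X$ is disjoint from $X$.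
   Formalization: In the definition of κ-O.K. only nonempty finite Γ are considered: for empty Γ the intersection is all of ω*, so the literal clause would force U_0 = ω* for every neighbourhood and fail for every co-meager semifilter. *)

(* Defs.v *)
From HB Require Import structures.
From mathcomp Require Import all_boot all_order all_algebra.
From mathcomp Require Import all_classical all_reals all_analysis.

Set Implicit Arguments.
Unset Strict Implicit.
Unset Printing Implicit Defensive.

Local Open Scope classical_set_scope.

Definition almost_subset (A B : set nat) : Prop := finite_set (A `\` B).

Definition almost_upward_closed (S : set (set nat)) : Prop :=
  forall A B, S A -> almost_subset A B -> S B.

Definition semifilter (S : set (set nat)) : Prop :=
  [/\ S !=set0, S <> setT & almost_upward_closed S].

Definition nowhere_dense (T : topologicalType) (N : set T) : Prop :=
  interior (closure N) = set0.

Definition meager (T : topologicalType) (M : set T) : Prop :=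
  exists2 N : nat -> set T,
    (forall n, nowhere_dense (N n)) & M = \bigcup_n N n.

Definition comeager (T : topologicalType) (M : set T) : Prop := meager (~` M).

(* A point x of 2^omega is identified with the set it is the indicator of. *)
Definition in_cantor (S : set (set nat)) : set cantor_space :=
  [set x : cantor_space | S [set n | x n]].

Definition filter_on_semifilter (S F : set (set nat)) : Prop :=
  [/\ F !=set0, F `<=` S, almost_upward_closed F &
      forall A B, F A -> F B -> F (A `&` B)].

Definition ultrafilter_on_semifilter (S F : set (set nat)) : Prop :=
  filter_on_semifilter S F /\
  forall G, filter_on_semifilter S G -> F `<=` G -> G = F.

Record omega_star : Type := OmegaStar {
  ultra_sets : set (set nat);
  ultra_setsP : UltraFilter ultra_sets;
  ultra_sets_free : \bigcap_(A in ultra_sets) A = set0 }.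

HB.instance Definition _ := gen_eqMixin omega_star.
HB.instance Definition _ := gen_choiceMixin omega_star.

Definition star (A : set nat) : set omega_star := [set p : omega_star | ultra_sets p A].

Lemma star_cover : \bigcup_(A in [set: set nat]) star A = setT.
Proof.
apply/seteqP; split => // p _; exists setT => //.
by have := ultra_setsP p => ?; exact: filterT.
Qed.

Lemma star_join (A B : set nat) (p : omega_star) :
  [set: set nat] A -> [set: set nat] B -> star A p -> star B p ->
  exists C, [/\ [set: set nat] C, star C p & star C `<=` star A `&` star B].
Proof.
move=> _ _ pA pB; exists (A `&` B); split => //.
  by have := ultra_setsP p => ?; exact: filterI.
move=> q qAB; have := ultra_setsP q => ?.
by split; apply: filterS qAB => n [].
Qed.

HB.instance Definition _ :=
  isBaseTopological.Build omega_star star_cover star_join.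

Definition stone_dual (F : set (set nat)) : set omega_star :=
  \bigcap_(A in F) star A.

(* The cardinal kappa is represented by an index type K of that cardinality.
   Only nonempty finite G are considered: for G empty the intersection is the
   whole space, and the condition would force U 0 to be the whole space. *)
Definition OK_set (K : Type) (X : set omega_star) : Prop :=
  closed X /\
  forall U : nat -> set omega_star,
    (forall n, open (U n) /\ X `<=` U n) ->
    exists2 V : K -> set omega_star,
      (forall g, set_nbhs X (V g)) &
      forall (n : nat) (G : set K), (0 < n)%N -> (G #= `I_n)%card ->
        \bigcap_(g in G) V g `<=` U n.

Definition weak_P_set (X : set omega_star) : Prop :=
  forall D : set omega_star, countable D -> D `<=` ~` X ->
    closure D `&` X = set0.

(* Main.v *)
Require Import Defs.
From mathcomp Require Import all_boot all_order all_algebra.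
From mathcomp Require Import all_classical all_reals all_analysis.
From mathcomp Require Import finmap wochoice.

(** By Talagrand's argument, a co-meager semifilter S contains the preimages of
    all infinite sets under some finite-to-one map b. Pulling back along b
    Kunen's independent linked family, one gets a family whose finite
    "cells" all belong to S. All sequences t of subsets of omega are then
    treated along a well-order with small initial segments. A filter base whose
    members meet every remaining cell in an element of S is extended in one of
    two ways: either some cell c makes the filter incompatible with t inside S,
    and c is added; or all the t n are added, with the threads made of t and of
    one index i of the family, which witness the O.K. condition for t. Each step
    spends finitely many indices. As there are as many indices as sequences of
    sequences t, Koenig's diagonal argument shows that they are never exhausted.
    Constant sequences t give maximality, and compactness of the Stone dual
    reduces neighbourhoods to elements of the filter. *)

Set Implicit Arguments.
Unset Strict Implicit.
Unset Printing Implicit Defensive.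

Local Open Scope classical_set_scope.

(** * Co-meager semifilters *)

Definition agree_below (n : nat) (x y : nat -> bool) : Prop :=
  forall i, (i < n)%N -> y i = x i.

Lemma nbhs_agree_below (x : cantor_space) (n : nat) :
  nbhs x (agree_below n x : set cantor_space).
Proof.
elim: n => [|n IH]; first by apply: filterS filterT => y _ i.
have xn : nbhs x [set y : cantor_space | y n = x n].
  have := @proj_continuous nat (fun=> bool) n x [set x n].
  by apply; exact: discrete_set1.
apply: filterS2 xn IH => y yn yx i; rewrite ltnS leq_eqVlt.
by case/predU1P => [->|/yx].
Qed.

(** The sets [agree_below n x] generate a filter that converges to [x] pointwise, hence in the
    product topology. *)
Lemma nbhs_cantorP (x : cantor_space) (A : set cantor_space) :
  nbhs x A -> exists n, agree_below n x `<=` A.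
Proof.
pose F : set_system cantor_space := filter_from setT (agree_below^~ x).
have FF : Filter F.
  apply: filter_from_filter; first by exists 0%N.
  move=> i j _ _; exists (maxn i j) => // y yx.
  by split=> k ki; apply: yx; rewrite leq_max ki ?orbT.
have : {ptws, F --> (x : nat -> bool)}.
  apply/pointwise_cvgP => t B /nbhs_singleton Bx.
  by exists t.+1 => // y /(_ t (ltnSn _)) yx; rewrite /= yx.
by move=> /[apply] -[n _ nA]; exists n.
Qed.

Lemma nowhere_dense_avoid (N : set cantor_space) (x : nat -> bool) (n : nat) :
  nowhere_dense N ->
  exists m (y : nat -> bool), [/\ (n <= m)%N, agree_below n x y &
    forall z, agree_below m y z -> ~ N z].
Proof.
move=> ndN; have [y [yx Ny]] : exists y : cantor_space,
    agree_below n x y /\ ~ closure N y.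
  apply: contrapT => /forallNP H.
  have : (closure N)° (x : cantor_space).
    apply: filterS (nbhs_agree_below x n) => y yx.
    by apply: contrapT => Ny; exact: (H y).
  by rewrite ndN.
have /nbhs_cantorP[m mN] : nbhs y (~` closure N).
  by apply: open_nbhs_nbhs; split => //; exact/closed_openC/closed_closure.
exists (maxn n m), y; split => //; first exact: leq_maxl.
move=> z zy /(@subset_closure cantor_space); apply: mN => i im; apply: zy.
by rewrite leq_max im orbT.
Qed.

Definition splice (k : nat) (t s : nat -> bool) : nat -> bool :=
  fun i => if (i < k)%N then t i else s i.

(** The pairs are treated one after the other, each prolonging the pattern built so far. Only values
    from [k] on matter in the end, and so one pattern can serve several prefixes [p.2]. *)
Lemma nowhere_dense_avoid_seq (l : seq (set cantor_space * (nat -> bool))) k n x :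
  (forall p, p \in l -> nowhere_dense p.1) -> (k <= n)%N ->
  exists m (y : nat -> bool), [/\ (n <= m)%N, agree_below n x y &
    forall p z, p \in l -> agree_below k p.2 z ->
      (forall i, (k <= i < m)%N -> z i = y i) -> ~ p.1 z].
Proof.
elim: l n x => [|[N t] l IH] n x ndl kn.
  by exists n, x; split.
have ndN : nowhere_dense N by apply: (ndl (N, t)); rewrite mem_head.
have [m [y [nm yx yN]]] := nowhere_dense_avoid (splice k t x) n ndN.
(* Below [k] the prefix [t] is traded back for [x], so that the pattern still extends [x]. *)
have [||m' [y' [mm' y'y H]]] := IH m (splice k x y).
- by move=> p pl; apply: ndl; rewrite in_cons pl orbT.
- exact: leq_trans nm.
exists m', y'; split; first exact: leq_trans mm'.
  move=> i ilt; rewrite y'y ?(leq_trans ilt)// /splice.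
  by case: ltnP => // ki; rewrite yx// /splice ltnNge ki.
move=> p z; rewrite in_cons => /predU1P[->/= zt zy|]; last exact: H.
apply: yN => i im; have [ik|ki] := ltnP i k.
  by rewrite zt// yx /splice ?ik// (leq_trans ik).
by rewrite zy ?ki ?(leq_trans im)// y'y// /splice ltnNge ki.
Qed.

Lemma nowhere_dense_block (N : nat -> set cantor_space) (n k : nat) :
  (forall n, nowhere_dense (N n)) ->
  exists m (y : nat -> bool), (k < m)%N /\
    forall z, (forall i, (k <= i < m)%N -> z i = y i) ->
      forall j, (j <= n)%N -> ~ N j z.
Proof.
move=> ndN.
pose ext (t : {ffun 'I_k -> bool}) : nat -> bool :=
  fun i => if insub i is Some j then t j else false.
(* There are finitely many prefixes of length [k], so one block can defeat them all, for every
   [j <= n]. *)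
pose l := [seq (N j, ext t) | j <- iota 0 n.+1, t <- enum {: {ffun 'I_k -> bool}}].
have ndl p : p \in l -> nowhere_dense p.1.
  by move=> /allpairsP[[j t] [_ _ ->]]; exact: ndN.
have [m [y [km _ H]]] :=
  nowhere_dense_avoid_seq (fun=> false) ndl (leqnSn k).
exists m, y; split => // z zy j jn.
pose t : {ffun 'I_k -> bool} := [ffun i => z (val i)].
apply: (H (N j, ext t)) => //.
  by apply/allpairsP; exists (j, t); split; rewrite ?mem_enum// mem_iota.
by move=> i ik; rewrite /= /ext insubT ffunE.
Qed.

Lemma comeager_finite_to_one (S : set (set nat)) :
  almost_upward_closed S -> comeager (in_cantor S) ->
  exists b : nat -> nat, (forall n, finite_set (b @^-1` [set n])) /\
    forall A, infinite_set A -> S (b @^-1` A).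
Proof.
move=> upS [N ndN SN].
have /choice[g gP] : forall p : nat * nat, exists my : nat * (nat -> bool),
    (p.2 < my.1)%N /\ forall z,
      (forall i, (p.2 <= i < my.1)%N -> z i = my.2 i) ->
      forall j, (j <= p.1)%N -> ~ N j z.
  move=> [n k]; have [m [y H]] := nowhere_dense_block n k ndN.
  by exists (m, y).
(* Cut points of the blocks: a point following the chosen pattern from [K n] to [K n.+1] avoids
   [N j] for all [j <= n]. *)
pose K := fix K n := if n is n'.+1 then (g (n', K n')).1 else 0%N.
have KS n : (K n < K n.+1)%N by case: (gP (n, K n)).
have Kmono : {homo K : m n / (m <= n)%N}.
  by apply: homo_leq => //; [exact: leq_trans | move=> n; exact/ltnW].
have /choice[b bP] x : exists n, (K n <= x < K n.+1)%N.
  elim: x => [|x [n /andP[Kn xK]]]; first by exists 0%N; rewrite /= (KS 0%N).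
  have [xK'|xK'] := ltnP x.+1 (K n.+1).
    by exists n; rewrite xK' (leq_trans Kn).
  by exists n.+1; rewrite xK' (leq_trans _ (KS n.+1)).
have bE n x : (K n <= x < K n.+1)%N -> b x = n.
  have /andP[b1 b2] := bP x => /andP[n1 n2]; apply/eqP; rewrite eqn_leq.
  apply/andP; split; rewrite leqNgt; apply/negP => /Kmono.
    by move=> /(leq_trans n2); rewrite ltnNge b1.
  by move=> /(leq_trans b2); rewrite ltnNge n1.
exists b; split.
  move=> n; apply: (sub_finite_set _ (finite_II (K n.+1))) => x /= <-.
  by have /andP[] := bP x.
move=> A infA.
(* [z] follows the pattern on the blocks indexed by [A] and vanishes elsewhere. As [A] is infinite,
   [z] escapes every [N j], and its set lies inside the preimage of [A]. *)
pose z : nat -> bool := fun x => `[< A (b x) >] && (g (b x, K (b x))).2 x.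
have Sz : S [set x | z x].
  suff : ~ (~` in_cantor S) z by rewrite /setC/= notK.
  rewrite SN => -[j _ Njz].
  have [n [An jn]] : exists n, A n /\ (j <= n)%N.
    apply: contrapT => /forallNP H; apply: infA.
    apply: (sub_finite_set _ (finite_II j)) => n An /=.
    by rewrite ltnNge; apply/negP => jn; exact: (H n).
  case: (gP (n, K n)) => /= _ /(_ z) H; apply: (H _ j jn Njz) => i iK.
  by rewrite /z (bE n)// (asboolT An).
apply: upS Sz _; rewrite /almost_subset.
suff -> : [set x | z x] `\` b @^-1` A = set0 by exact: finite_set0.
by apply/seteqP; split=> // x [/andP[/asboolP]].
Qed.

(** * Kunen's independent linked family *)

Definition trace (k : nat) (X : nat -> bool) : {set 'I_k} := finset (fun i : 'I_k => X i).

Definition code := {k : nat & {ffun {set 'I_k} -> {set {set 'I_k}}}}.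

(* In a code (k, f), the function f lists the traces on k that the sets
   indexed by Y may have, given the trace on k of the index X. *)
Definition kunen (X : nat -> bool) (n : nat) (Y : nat -> bool) : set code :=
  [set c : code | (#|tagged c (trace (tag c) X)| <= n)%N /\
           trace (tag c) Y \in tagged c (trace (tag c) X)].

Lemma kunen_mono X m n Y : (m <= n)%N -> kunen X m Y `<=` kunen X n Y.
Proof. by move=> mn c [cm ?]; split=> //; exact: leq_trans mn. Qed.

Lemma finite_tag_lt K : finite_set [set c : code | (tag c < K)%N].
Proof.
have := bigcup_finite (finite_II K) (fun k _ =>
  finite_image (Tagged (fun k => {ffun {set 'I_k} -> {set {set 'I_k}}}))
    (@finite_finset _ [set: {ffun {set 'I_k} -> {set {set 'I_k}}}])).
apply: sub_finite_set => -[k f] /= kK.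
by exists k => //; exists f.
Qed.

Lemma trace_inj (s : seq (nat -> bool)) :
  exists K, forall k, (K <= k)%N -> {in s &, injective (trace k)}.
Proof.
have sep (X Y : nat -> bool) :
    exists K, forall k, (K <= k)%N -> trace k X = trace k Y -> X = Y.
  have [->|XY] := pselect (X = Y); first by exists 0%N.
  have [i Xi] : exists i, X i <> Y i.
    by apply: contrapT => /forallNP H; apply: XY; apply/funext => i; apply: contrapT.
  exists i.+1 => k ik /setP/(_ (Ordinal ik)); rewrite !inE /=.
  by move=> ?; exfalso; exact: Xi.
have seps X (r : seq (nat -> bool)) : exists K, forall k, (K <= k)%N ->
    forall Y, Y \in r -> trace k X = trace k Y -> X = Y.
  elim: r => [|Y r [K IH]]; first by exists 0%N.
  have [K' H] := sep X Y; exists (maxn K K') => k; rewrite geq_max => /andP[k1 k2] Z.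
  by rewrite in_cons => /predU1P[->|]; [exact: H | exact: IH].
elim: s => [|X s [K IH]]; first by exists 0%N.
have [K' H] := seps X (X :: s); exists (maxn K K') => k.
rewrite geq_max => /andP[k1 k2] Y Z; rewrite in_cons => /predU1P[->|Ys] Zs.
  exact: H.
move: Zs; rewrite in_cons => /predU1P[->|Zs]; last exact: IH.
by move=> /esym E; apply/esym; apply: (H k k2) => //; rewrite in_cons Ys orbT.
Qed.

(** For large tags the traces of [s] are distinct, and more than [n] of them do not fit in a set of
    size at most [n]. Only codes with small tags remain. *)
Lemma kunen_linked X n (s : seq (nat -> bool)) : uniq s -> (n < size s)%N ->
  finite_set [set c | forall Y, Y \in s -> kunen X n Y c].
Proof.
move=> us ns; have [K Kinj] := trace_inj s.
apply: sub_finite_set (finite_tag_lt K) => c cs /=; rewrite ltnNge.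
apply/negP => /Kinj inj; have {}us : uniq (map (trace (tag c)) s).
  by rewrite map_inj_in_uniq.
have [Y Ys] : exists Y, Y \in s by case: (s) ns => // Y ? _; exists Y; rewrite mem_head.
have [cn _] := cs _ Ys; move: ns; rewrite ltnNge (leq_trans _ cn)//.
rewrite -(size_map (trace (tag c))) cardE uniq_leq_size// => _ /mapP[Z Zs ->].
by rewrite mem_enum; have [] := cs _ Zs.
Qed.

Lemma infinite_geq K : infinite_set [set k | (K <= k)%N].
Proof.
move=> fin; apply: infinite_nat.
apply: sub_finite_set (_ : finite_set ([set k | (K <= k)%N] `|` `I_K)).
  by move=> k _ /=; case: (leqP K k); [left|right].
by rewrite finite_setU; split=> //; exact: finite_II.
Qed.

Lemma uniq_unzip1_inj (T U : eqType) (l : seq (T * U)) : uniq (unzip1 l) ->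
  {in l &, injective fst}.
Proof.
move=> ul p q /(nthP p)[i il <-] /(nthP p)[j jl <-] /eqP.
rewrite -!(nth_map p p.1) ?size_map// nth_uniq ?size_map//.
by move=> /eqP ->.
Qed.

(** For every large [k] the first components of [l] have distinct traces, so a single [f] can
    prescribe the traces of [p.2] at each of them. This gives a code for each large tag. *)
Lemma kunen_independent (l : seq ((nat -> bool) * seq (nat -> bool))) :
  uniq (unzip1 l) ->
  infinite_set [set c | forall p, p \in l ->
    forall Y, Y \in p.2 -> kunen p.1 (size p.2) Y c].
Proof.
move=> ul fin; have [K Kinj] := trace_inj (unzip1 l).
apply: (@infinite_geq K); apply: sub_finite_set (finite_image (@tag _ _) fin).
move=> k Kk /=.
(* [f] looks up the pair whose first component has trace [Z]; the empty set is the default where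
   there is none. *)
pose f : {ffun {set 'I_k} -> {set {set 'I_k}}} := [ffun Z =>
  if [seq p <- l | trace k p.1 == Z] is p :: _
  then finset (fun W => W \in map (trace k) p.2) else finset.set0].
exists (Tagged (fun k => {ffun {set 'I_k} -> {set {set 'I_k}}}) f) => //.
move=> p pl Y Yp; rewrite /kunen /= /f ffunE.
case E : [seq _ <- _ | _] => [|q r].
  have : p \in [seq p0 <- l | trace k p0.1 == trace k p.1].
    by rewrite mem_filter eqxx.
  by rewrite E.
have : q \in [seq p0 <- l | trace k p0.1 == trace k p.1] by rewrite E mem_head.
rewrite mem_filter => /andP[/eqP qp ql].
have -> : q = p.
  apply: (uniq_unzip1_inj ul) => //; apply: (Kinj k Kk) => //; exact: map_f.
split; last by rewrite inE map_f.
by rewrite -(size_map (trace k)) cardsE card_size.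
Qed.

(** Kunen's family is pulled back along [b] and the numbering of codes. Linkedness survives because
    [b] is finite-to-one; cells are in [S] because they contain preimages of infinite sets. *)
Lemma independent_linked_family (I : eqType) (h : I -> nat -> bool)
    (S : set (set nat)) (b : nat -> nat) :
  injective h -> almost_upward_closed S ->
  (forall n, finite_set (b @^-1` [set n])) ->
  (forall E, infinite_set E -> S (b @^-1` E)) ->
  exists A : I -> nat -> (nat -> bool) -> set nat, [/\
    forall i m n a, (m <= n)%N -> A i m a `<=` A i n a,
    forall i n s, uniq s -> (n < size s)%N ->
      finite_set [set x | forall a, a \in s -> A i n a x] &
    forall l : seq (I * seq (nat -> bool)), uniq (unzip1 l) ->
      S [set x | forall p, p \in l ->
        forall a, a \in p.2 -> A p.1 (size p.2) a x]].
Proof.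
move=> hinj upS bfin bS.
exists (fun i n a =>
  [set x | exists2 c : code, choice.pickle c = b x & kunen (h i) n a c]).
split.
- by move=> i m n a mn x [c cx /(kunen_mono mn)]; exists c.
- move=> i n s us ns; have fin := kunen_linked (h i) us ns.
  apply: sub_finite_set (bigcup_finite fin (fun c _ => bfin (choice.pickle c))) => x xs.
  have [Y Ys] : exists Y, Y \in s by case: (s) ns => // Y ? _; exists Y; rewrite mem_head.
  have [c cx cY] := xs _ Ys; exists c => // Z /xs[c' c'x].
  by rewrite (_ : c' = c)//; apply: (pcan_inj (@choice.pickleK code)); rewrite cx.
- move=> l ul; pose l' := [seq (h p.1, p.2) | p <- l].
  have ul' : uniq (unzip1 l').
    by rewrite /unzip1 -map_comp (_ : _ \o _ = h \o fst)// map_comp map_inj_uniq.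
  have inf := kunen_independent ul'.
  have infp : infinite_set (choice.pickle @` [set c | forall p, p \in l' ->
      forall Y, Y \in p.2 -> kunen p.1 (size p.2) Y c]).
    move=> fin; apply: inf.
    apply: sub_finite_set (finite_preimage _ fin) => [c ? |c c' _ _]; first by exists c.
    exact: (pcan_inj (@choice.pickleK code)).
  apply: upS (bS _ infp) _; apply: sub_finite_set (@finite_set0 nat).
  move=> x /= [[c cl cx] +]; apply=> /=.
  move=> p pl a ap; exists c => //.
  by apply: (cl (h p.1, p.2)) => //; apply/mapP; exists p.
Qed.

(** * Well-orders with small initial segments *)

(* Any well-order of T, cut at the first point whose initial segment maps
   onto T, if there is one. *)
Lemma small_well_order (T : eqType) : exists R : T -> T -> Prop, [/\
    forall E : set T, E !=set0 -> exists2 z, E z & forall x, E x -> R z x,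
    forall s t, R s t -> R t s -> s = t &
    forall t, ~ exists f : T -> T,
      forall y, exists s, [/\ R s t, s <> t & f s = y]].
Proof.
have [R0 wo] := well_ordering_principle T.
have minR (E : set T) : E !=set0 -> exists2 z, E z & forall x, E x -> R0 z x.
  move=> [x Ex]; have [|z [[zE zmin] _]] := wo (fun x => `[< E x >]).
    by exists x; exact/asboolP.
  exists z; first by move/asboolP : zE.
  by move=> y Ey; apply: zmin; exact/asboolP.
have antiR s t : R0 s t -> R0 t s -> s = t.
  move=> st ts; have tt : R0 t t.
    by have [z ->] := minR [set t] (ex_intro _ t erefl); exact.
  have ss : R0 s s.
    by have [z ->] := minR [set s] (ex_intro _ s erefl); exact.
  have [|z [_ zu]] := wo (pred2 s t); first by exists s; rewrite inE eqxx.
  rewrite -(zu s) ?(zu t)//; split=> /=; rewrite ?inE ?eqxx ?orbT//;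
    by move=> x; rewrite !inE => /orP[]/eqP ->.
pose large t := exists f : T -> T, forall y, exists s, [/\ R0 s t, s <> t & f s = y].
have [lar|nlar] := pselect (large !=set0); last first.
  by exists R0; split=> // t lt; apply: nlar; exists t.
have [t0 [f fP] t0min] := minR _ lar.
have [g gP] := choice fP.
have ginj : injective g.
  by move=> x y gxy; have [_ _ <-] := gP x; rewrite gxy; have [] := gP y.
(* The section [g] of [f] copies [T] into the segment below [t0]. If the segment below [t] still
   mapped onto [T], then [g t] would be large, against the minimality of [t0]. *)
exists (fun s t => R0 (g s) (g t)); split.
- move=> E [x Ex]; have [|z [y Ey <-] zmin] := minR (g @` E); first by exists (g x), x.
  by exists y => // w Ew; apply: zmin; exists w.
- by move=> s t st ts; apply: ginj; exact: antiR.
- move=> t [f' f'P]; have [gt0 gtn _] := gP t; apply: gtn; apply: antiR gt0 _.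
  apply: t0min; exists (f' \o f) => y; have [s [st sn <-]] := f'P y.
  by exists (g s); split=> //=; [move/ginj | have [_ _ ->] := gP s].
Qed.

(* Koenig's diagonal argument. *)
Lemma sequences_cover_surjection (T U : Type) (D : set U) (g : U -> nat -> nat -> T) :
  (forall i : nat -> T, exists2 s, D s & exists n, g s n = i) ->
  exists f : U -> T, forall y, exists2 s, D s & f s = y.
Proof.
move=> cov; apply: contrapT => /forallNP nsurj.
(* The map sending [s] to [g s n n] is not onto; [y n] is a value it misses. Thus [y] differs from
   each [g s n] at [n]. *)
have /choice[y yP] n : exists y, forall s, D s -> g s n n <> y.
  apply: contrapT => /forallNP H; apply: (nsurj (fun s => g s n n)) => y.
  by apply: contrapT => nex; apply: (H y) => s Ds gy; apply: nex; exists s.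
by have [s Ds [n gsn]] := cov y; apply: (yP n s Ds); rewrite gsn.
Qed.

(** * Construction of the filter base *)

Definition meet (l : seq (set nat)) : set nat :=
  [set x | forall B, B \in l -> B x].

Definition initial_meet (t : nat -> set nat) (n : nat) : set nat :=
  [set x | forall k, (k <= n)%N -> t k x].

Section construction.
Variables (S : set (set nat)) (I J : eqType) (A : I -> nat -> J -> set nat).
Hypothesis S_up : almost_upward_closed S.
Hypothesis A_mono : forall i m n a, (m <= n)%N -> A i m a `<=` A i n a.
Hypothesis A_linked : forall i n s, uniq s -> (n < size s)%N ->
  finite_set [set x | forall a, a \in s -> A i n a x].

(** Each index is used at the level equal to its number of parameters, the lowest at which
    linkedness does not force a finite intersection. *)
Definition cell (c : seq (I * seq J)) : set nat :=
  [set x | forall p, p \in c -> forall a, a \in p.2 -> A p.1 (size p.2) a x].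

Definition fresh (U : set I) (c : seq (I * seq J)) : Prop :=
  uniq (unzip1 c) /\ forall i, i \in unzip1 c -> ~ U i.

(** The invariant of the construction. With [c] empty it puts the finite meets of [G] in [S]; the
    other cells keep the indices outside [U] available for later steps. *)
Definition independent (G : set (set nat)) (U : set I) : Prop :=
  forall l c, (forall B, B \in l -> G B) -> fresh U c -> S (meet l `&` cell c).

Lemma upward_closed_sub B C : B `<=` C -> S B -> S C.
Proof.
move=> BC SB; apply: S_up SB _; apply: sub_finite_set (@finite_set0 nat).
by move=> x [/BC].
Qed.

(** Cells over disjoint sets of indices concatenate into one cell, so [cell c0] can be moved from
    the meet into the test cell. *)
Lemma independent_cell G U c0 : fresh U c0 -> independent G U ->
  independent (G `|` [set cell c0]) (U `|` [set` unzip1 c0]).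
Proof.
move=> [uc0 c0U] ind l c lG [uc cU].
have Sl : S (meet [seq B <- l | `[< G B >]] `&` cell (c ++ c0)).
  apply: ind; first by move=> B; rewrite mem_filter => /andP[/asboolP].
  split.
    rewrite /unzip1 map_cat cat_uniq uc uc0 andbT; apply/hasPn => i ic0.
    by apply/negP => /cU; apply; right.
  move=> i; rewrite /unzip1 map_cat mem_cat => /orP[/cU iU|/c0U//].
  by move=> Ui; apply: iU; left.
apply: upward_closed_sub Sl => x [xl xc]; split; last first.
  by move=> p pc; apply: xc; rewrite mem_cat pc.
move=> B Bl; have [GB|->] := lG _ Bl.
  by apply: xl; rewrite mem_filter Bl andbT; exact/asboolP.
by move=> p pc; apply: xc; rewrite mem_cat pc orbT.
Qed.

(** The condition [n <= x] leaves no point in all levels, so that a point of one level has a last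
    one. *)
Definition level (t : nat -> set nat) (n : nat) : set nat :=
  [set x | (n <= x)%N] `&` initial_meet t n.

(* A point x of thread t i a lies in A i m a for the last m such that
   level t m x, so a point common to n threads which is not in t n lies in n
   sets A i m a with m < n. *)
Definition thread (t : nat -> set nat) (i : I) (a : J) : set nat :=
  [set x | exists m, [/\ level t m x, ~ level t m.+1 x & A i m a x]].

Lemma level_anti t m n : (m <= n)%N -> level t n `<=` level t m.
Proof.
move=> mn x [nx tx]; split; first exact: leq_trans nx.
by move=> k km; apply: tx; exact: leq_trans mn.
Qed.

Lemma level_exit t n x : level t n x ->
  exists m, [/\ (n <= m)%N, level t m x & ~ level t m.+1 x].
Proof.
have [d] : exists d, (x < n + d)%N by exists x.+1; rewrite ltn_addl.
elim: d n => [|d IH] n xn tn.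
  by case: tn; rewrite addn0 in xn; rewrite /= leqNgt xn.
have [tSn|tSn] := pselect (level t n.+1 x); last by exists n.
have [|m [nm tm tSm]] := IH n.+1 _ tSn; first by rewrite addSnnS.
by exists m; split=> //; exact: ltnW.
Qed.

Lemma thread_linked t i s : uniq s -> (0 < size s)%N ->
  finite_set ([set x | forall a, a \in s -> thread t i a x] `\` t (size s)).
Proof.
move=> us s0.
have fin : finite_set (\bigcup_(m in `I_(size s))
    [set x | forall a, a \in s -> A i m a x]).
  by apply: bigcup_finite => [|m ms]; [exact: finite_II | exact: A_linked].
apply: sub_finite_set fin => x [xs nt].
have [a as_] : exists a, a \in s by case: (s) s0 => // a ? _; exists a; rewrite mem_head.
have [m [tm ntm _]] := xs _ as_; have [ms|sm] := ltnP m (size s); last first.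
  by exfalso; apply: nt; have [_] := level_anti sm tm; apply.
(* Levels decrease, so the last level of [x] is unique and the same [m] serves every [a'] in [s]. *)
exists m => // a' /xs[m' [tm' ntm']]; suff -> : m' = m by [].
apply/eqP; rewrite eqn_leq; apply/andP; split; rewrite leqNgt; apply/negP => lt.
  exact/ntm/(level_anti lt).
exact/ntm'/(level_anti lt).
Qed.

Lemma independent_thread G U t i : ~ U i ->
  (forall l c n, (forall B, B \in l -> G B) -> fresh U c ->
     S (meet l `&` initial_meet t n `&` cell c)) ->
  independent (G `|` range t `|` range (thread t i)) (U `|` [set i]).
Proof.
move=> Ui ind l c lG [uc cU].
(* The list [l] is sorted into old sets, terms of [t] and threads. *)
have [l0 [n [s [l0G sub]]]] : exists l0 n (s : seq J),
    (forall B, B \in l0 -> G B) /\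
    forall x, meet l0 x -> initial_meet t n x ->
      (forall a, a \in s -> thread t i a x) -> meet l x.
  elim: l lG => [|B l IH] lG; first by exists [::], 0%N, [::]; split.
  have [|l0 [n [s [l0G sub]]]] := IH.
    by move=> B' Bl; apply: lG; rewrite in_cons Bl orbT.
  have [[GB|[k _ kB]]|[a _ aB]] := lG B (mem_head _ _).
  - exists (B :: l0), n, s; split.
      by move=> B'; rewrite in_cons => /predU1P[->|/l0G].
    move=> x xl0 xn xs B'; rewrite in_cons => /predU1P[->|].
      by apply: xl0; rewrite mem_head.
    by apply: sub => // B'' B''l; apply: xl0; rewrite in_cons B''l orbT.
  - exists l0, (maxn n k), s; split=> // x xl0 xn xs B'.
    rewrite in_cons => /predU1P[->|].
      by rewrite -kB; apply: xn; rewrite leq_maxr.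
    by apply: sub => // j jn; apply: xn; rewrite leq_max jn.
  - exists l0, n, (a :: s); split=> // x xl0 xn xs B'.
    rewrite in_cons => /predU1P[->|].
      by rewrite -aB; apply: xs; rewrite mem_head.
    by apply: sub => // b bs; apply: xs; rewrite in_cons bs orbT.
(* [n] takes care of the terms of [t]. Beyond [k], the last level of a point is at least [size s],
   so by monotonicity the cell of [(i, s)] lies in the threads. *)
pose k := maxn n (size s).
have Sl : S (meet l0 `&` initial_meet t k `&` cell ((i, s) :: c)).
  apply: ind => //; split=> /=.
    by rewrite uc andbT; apply/negP => /cU; apply; right.
  by move=> j; rewrite in_cons => /predU1P[->//|/cU jU Uj]; apply: jU; left.
apply: S_up Sl _; apply: sub_finite_set (finite_II k) => x [[[xl0 xk] xc]] nx /=.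
rewrite ltnNge; apply/negP => kx; apply: nx; split; last first.
  by move=> p pc; apply: xc; rewrite in_cons pc orbT.
apply: sub => // [j jn|a as_]; first by apply: xk; rewrite leq_max jn.
have [m [km tm ntm]] := level_exit (conj kx xk).
exists m; split=> //; apply: (@A_mono _ (size s)).
  by apply: leq_trans km; rewrite leq_maxr.
by apply: (xc (i, s)) => //; rewrite mem_head.
Qed.

(* Either no filter on S extending G contains all the t n, or G contains them
   together with a family witnessing the O.K. condition for the sequence t. *)
Definition settles (G : set (set nat)) (t : nat -> set nat) : Prop :=
  (exists l n, (forall B, B \in l -> G B) /\ ~ S (meet l `&` initial_meet t n)) \/
  ((forall n, G (t n)) /\
   exists V : J -> set nat, (forall a, G (V a)) /\
     forall s, uniq s -> (0 < size s)%N ->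
       finite_set ([set x | forall a, a \in s -> V a x] `\` t (size s))).

Lemma settlesS G G' t : G `<=` G' -> settles G t -> settles G' t.
Proof.
move=> GG' [[l [n [lG nS]]]|[tG [V [VG H]]]].
  by left; exists l, n; split=> // B /lG /GG'.
by right; split=> [n|]; [exact: GG' | exists V; split=> // a; exact: GG'].
Qed.

Lemma independent_settle G U t : (exists i, ~ U i) -> independent G U ->
  exists (e : seq I) G', [/\ G' !=set0, independent (G `|` G') (U `|` [set` e]) &
    settles (G `|` G') t].
Proof.
move=> [i Ui] ind.
have [[l [c [n [lG cU nS]]]]|nkill] := pselect (exists l c n,
    [/\ (forall B, B \in l -> G B), fresh U c &
        ~ S (meet l `&` initial_meet t n `&` cell c)]).
  exists (unzip1 c), [set cell c]; split; first by exists (cell c).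
    exact: independent_cell.
  left; exists (cell c :: l), n; split.
    by move=> B; rewrite in_cons => /predU1P[->|/lG]; [right | left].
  apply: contra_not nS; apply: upward_closed_sub => x [xl xn].
  by repeat split=> //; [move=> B Bl; apply: xl; rewrite in_cons Bl orbT|
    apply: xl; rewrite mem_head].
exists [:: i], (range t `|` range (thread t i)); split.
- by exists (t 0%N); left; exists 0%N.
- have -> : [set` [:: i]] = [set i].
    by apply/seteqP; split=> j /=; rewrite inE => /eqP.
  rewrite setUA; apply: independent_thread => // l c n lG cU.
  by apply: contrapT => nS; apply: nkill; exists l, c, n.
- right; split; first by move=> n; right; left; exists n.
  exists (thread t i); split; first by move=> a; right; right; exists a.
  by move=> s us s0; exact: thread_linked.
Qed.

End construction.

(** * Transfinite treatment of all sequences *)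

Section transfinite.
Local Notation T := (nat -> set nat).
Local Notation I := (nat -> T).
Variables (S : set (set nat)) (J : eqType) (A : I -> nat -> J -> set nat).
Hypothesis S_up : almost_upward_closed S.
Hypothesis A_mono : forall i m n a, (m <= n)%N -> A i m a `<=` A i n a.
Hypothesis A_linked : forall i n s, uniq s -> (n < size s)%N ->
  finite_set [set x | forall a, a \in s -> A i n a x].
Hypothesis A_indep : forall c, uniq (unzip1 c) -> S (cell A c).

(* A stage of the construction is the set of triples (t, e, B) such that, when
   the sequence t was treated, the indices in e were spent and B was added to
   the filter base. *)
Let stage := set (T * seq I * set nat).

Let added (X : stage) : set (set nat) := [set B | exists t e, X (t, e, B)].
Let spent (X : stage) : set I :=
  [set i | exists t e B, X (t, e, B) /\ i \in e].
Let treated (X : stage) : set T := [set t | exists e B, X (t, e, B)].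

Let addedS X Y : X `<=` Y -> added X `<=` added Y.
Proof. by move=> XY B [t [e /XY]]; exists t, e. Qed.

Let spentS X Y : X `<=` Y -> spent X `<=` spent Y.
Proof. by move=> XY i [t [e [B [/XY XB ie]]]]; exists t, e, B. Qed.

(** Zorn's lemma replaces the recursion: a maximal good stage treats every sequence, since otherwise
    the least untreated one could be treated next. *)
Lemma settling_base : exists G : set (set nat),
  (forall l, (forall B, B \in l -> G B) -> S (meet l)) /\
  forall t, settles S J G t.
Proof.
have [R [Rwo Ranti Rsmall]] := small_well_order T.
pose good (X : stage) := [/\
  forall t e e' B B', X (t, e, B) -> X (t, e', B') -> e = e',
  forall s t, R s t -> treated X t -> treated X s,
  independent S A (added X) (spent X) &
  forall t, treated X t -> settles S J (added X) t].
have good0 : good set0.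
  split; [by [] | by move=> s t _ [e [B []]] | | by move=> t [e [B []]]].
  move=> [|B l] c lG [uc _]; last by have [t [e []]] := lG B (mem_head _ _).
  by apply: (upward_closed_sub S_up _ (A_indep uc)).
have [X [[Xfun Xinit Xind Xset] Xmax]] : exists X, good X /\
    forall Y, X `<` Y -> ~ good Y.
  apply: Zorn_bigcup => F Fgood Ftot; set X := \bigcup_(Y in F) Y.
  have sub Y : F Y -> Y `<=` X by move=> FY; exact: bigcup_sup.
  split.
  - move=> t e e' B B' [Y FY YB] [Z FZ ZB].
    have [YZ|ZY] := Ftot _ _ FY FZ.
      by have [H _ _ _] := Fgood _ FZ; apply: (H t e e' B B') => //; exact: YZ.
    by have [H _ _ _] := Fgood _ FY; apply: (H t e e' B B') => //; exact: ZY.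
  - move=> s t st [e [B [Y FY YB]]]; have [_ H _ _] := Fgood _ FY.
    have [|e' [B' YB']] := H s t st; first by exists e, B.
    by exists e', B', Y.
  - move=> l c lX [uc cX].
    (* Independence concerns finitely many sets at a time, and these all come from one member of the
       chain; [set0] serves the empty list. *)
    have [Y [gY YX lY]] : exists Y, [/\ Y = set0 \/ F Y, Y `<=` X &
        forall B, B \in l -> added Y B].
      elim: l lX => [_|B l IH lX]; first by exists set0; split=> //; left.
      have [|Y [FY YX lY]] := IH.
        by move=> B' Bl; apply: lX; rewrite in_cons Bl orbT.
      have [t [e [Z FZ ZB]]] := lX B (mem_head _ _).
      have [YZ|ZY] : Y `<=` Z \/ Z `<=` Y.
        by case: FY => [->|FY]; [left | exact: Ftot].
        exists Z; split; [by right | exact: sub |] => B'.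
        rewrite in_cons => /predU1P[->|/lY]; first by exists t, e.
        exact: addedS.
      exists Y; split=> // B'; rewrite in_cons => /predU1P[->|/lY//].
      by exists t, e; exact: ZY.
    have [_ _ H _] : good Y by case: gY => [->|/Fgood].
    by apply: H => //; split=> // i /cX iX /(spentS YX).
  - move=> t [e [B [Y FY YB]]]; have [_ _ _ H] := Fgood _ FY.
    apply: settlesS (H t _); last by exists e, B.
    exact/addedS/sub.
suff all t : treated X t.
  exists (added X); split=> [l lX|t]; last exact: Xset.
  have fr : fresh (spent X) ([::] : seq (I * seq J)) by [].
  by apply: (upward_closed_sub S_up _ (Xind l [::] lX fr)) => x [].
apply: contrapT => nt.
have [{}t {}nt tmin] : exists2 t, ~ treated X t & forall s, ~ treated X s -> R t s.
  by apply: Rwo; exists t.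
have below s : treated X s -> R s t /\ s <> t.
  move=> sX; split; last by move=> st; rewrite st in sX.
  have [z [->|->] zmin] := Rwo [set s; t] (ex_intro _ s (or_introl erefl)).
    by apply: zmin; right.
  by exfalso; apply/nt/(Xinit _ s) => //; apply: zmin; left.
(* Were all indices spent, the finite lists [e s] with [s] below [t] would enumerate [I], whose
   elements are sequences in [T]. The diagonal argument would then map the segment below [t] onto
   [T]. *)
have [i iX] : exists i, ~ spent X i.
  apply: contrapT => /forallNP all.
  have /choice[e eP] s : exists e, treated X s -> exists B, X (s, e, B).
    by have [[e XB]|ns] := pselect (treated X s); [exists e | exists [::]].
  apply: (Rsmall t); have [|f fsurj] := @sequences_cover_surjection (nat -> set nat)
      T (treated X) (fun s n => nth (fun _ _ => set0) (e s) n).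
    move=> i; have /contrapT[s [e' [B [XB ie']]]] := all i.
    exists s; first by exists e', B.
    have [|B' XB'] := eP s; first by exists e', B.
    by rewrite (Xfun _ _ _ _ _ XB XB') in ie'; exists (index i (e s)); rewrite nth_index.
  by exists f => y; have [s /below[]] := fsurj y; exists s.
have [e [G' [[B0 G'B0] ind sett]]] :=
  independent_settle S_up A_mono A_linked t (ex_intro _ i iX) Xind.
(* Since [G'] contains [B0], this really marks [t] as treated and [e] as spent. *)
pose Y : stage := X `|` [set y | [/\ y.1.1 = t, y.1.2 = e & G' y.2]].
have addedY : added Y = added X `|` G'.
  apply/seteqP; split=> B.
    by move=> [s [e' [XB|[_ _]]]]; [left; exists s, e' | right].
  by move=> [[s [e' XB]]|G'B]; [exists s, e'; left | exists t, e; right].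
have spentY : spent Y = spent X `|` [set` e].
  apply/seteqP; split=> j.
    by move=> [s [e' [B [[XB|[_ /= <- _]] je]]]]; [left; exists s, e', B | right].
  move=> [[s [e' [B [XB je]]]]|je]; first by exists s, e', B; split=> //; left.
  by exists t, e, B0; split=> //; right.
have XY : X `<` Y.
  split; first exact: subsetUl.
  by move=> YX; apply: nt; exists e, B0; apply: YX; right.
apply: (Xmax Y XY); split.
- move=> s e1 e2 B1 B2 [X1|[/= st -> _]] [X2|[/= st' -> _]]//.
  + exact: Xfun X1 X2.
  + by move: nt; rewrite -st' => -[]; exists e1, B1.
  + by move: nt; rewrite -st => -[]; exists e2, B2.
- move=> s u su [e' [B' uB']]; have [sX|sX] := pselect (treated X s).
    by have [e1 [B1 X1]] := sX; exists e1, B1; left.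
  have [uX|[/= ut _ _]] := uB'.
    by exfalso; apply/sX/(Xinit _ u) => //; exists e', B'.
  have -> : s = t by apply: Ranti (tmin _ sX); rewrite -ut.
  by exists e, B0; right.
- by rewrite addedY spentY.
- rewrite addedY => s [e' [B' [XB|[/= -> _ _]]]] //.
  apply: settlesS (Xset s _); last by exists e', B'.
  exact: subsetUl.
Qed.

End transfinite.

(** * Stone duals *)

Lemma open_omega_starP (U : set omega_star) :
  open U <-> forall p, U p -> exists2 A, star A p & star A `<=` U.
Proof.
split=> [[D _ <-] p [A DA pA]|H]; first by exists A => //; exact: bigcup_sup.
exists [set A | star A `<=` U] => //; apply/seteqP; split=> [p [A AU]|p /H[A]].
  exact: AU.
by exists A.
Qed.

Lemma open_star A : open (star A).
Proof. by apply/open_omega_starP => p pA; exists A. Qed.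

Lemma starS A B : A `<=` B -> star A `<=` star B.
Proof. by move=> AB p; have := ultra_setsP p => ?; exact: filterS. Qed.

Lemma starI A B : star (A `&` B) = star A `&` star B.
Proof.
apply/seteqP; split=> p; have := ultra_setsP p => ?.
  by move=> pAB; split; apply: filterS pAB => x [].
by case; exact: filterI.
Qed.

Lemma starC A : star (~` A) = ~` star A.
Proof.
apply/seteqP; split=> p; have := ultra_setsP p => pU.
  move=> pnA pA; apply: (@filter_not_empty _ (ultra_sets p)).
  by apply: filterS (filterI pA pnA) => x [].
by move=> npA; have [|] := in_ultra_setVsetC A pU.
Qed.

Lemma star_cofinite A : finite_set (~` A) -> star A = setT.
Proof.
move=> finA; apply/seteqP; split=> // p _; have := ultra_setsP p => pU.
have [//|pnA] := in_ultra_setVsetC A pU; exfalso.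
have pn n : ultra_sets p (~` [set n]).
  have [pn|//] := in_ultra_setVsetC [set n] pU.
  have : ~ (\bigcap_(B in ultra_sets p) B) n by rewrite ultra_sets_free.
  move=> nn; exfalso; apply: nn => B pB; have := filter_ex (filterI pn pB).
  by move=> [_ [->]].
apply: (@filter_not_empty _ (ultra_sets p)).
have pI : ultra_sets p (\bigcap_(n in [set` fset_set (~` A)]) ~` [set n]).
  by apply: filter_bigI => n _; exact: pn.
apply: filterS (filterI pnA pI) => x [nAx] /(_ x); apply => //=.
by rewrite in_fset_set//; exact: mem_set.
Qed.

Lemma star_almost_subset A B : almost_subset A B -> star A `<=` star B.
Proof.
move=> AB p pA; suff : star (A `&` ~` (A `\` B)) p.
  by apply: starS => x [Ax]; rewrite /setD /= not_andP notK => -[|].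
by rewrite starI; split=> //; rewrite star_cofinite// setCK.
Qed.

Lemma closed_stone_dual F : closed (stone_dual F).
Proof.
apply: closed_bigI => A _; rewrite -[star A]setCK -starC.
exact/open_closedC/open_star.
Qed.

(** This is compactness: if no [star B] fits in [U], the sets whose star contains some [star B]
    minus [U] form a proper filter. *)
Lemma stone_dual_compact (F : set (set nat)) (U : set omega_star) :
  F !=set0 -> almost_upward_closed F -> (forall A B, F A -> F B -> F (A `&` B)) ->
  open U -> stone_dual F `<=` U -> exists2 B, F B & star B `<=` U.
Proof.
move=> [B0 FB0] upF FI /open_omega_starP oU FU.
apply: contrapT => /forall2NP nB.
(* A free ultrafilter extending H lies in the dual of F but not in U. *)
pose H : set_system nat := [set A | exists2 B, F B & star B `\` U `<=` star A].
have HF : ProperFilter H.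
  split; first by move=> [B FB BU]; have [//|] := nB B; apply=> p Bp;
    apply: contrapT => Up; have /BU := conj Bp Up; have := ultra_setsP p => ?;
    exact: filter_not_empty.
  split.
  - exists B0 => // p _; have := ultra_setsP p => ?; exact: filterT.
  - move=> A A' [B FB BA] [B' FB' BA']; exists (B `&` B'); first exact: FI.
    by rewrite !starI => p [[pB pB'] nU]; split; [exact: BA | exact: BA'].
  - move=> A A' AA' [B FB BA]; exists B => //.
    by apply: subset_trans BA _; exact: starS.
have [G [GU HG]] := ultraFilterLemma HF.
have Gcof A : finite_set (~` A) -> G A.
  by move=> finA; apply: HG; exists B0 => //; rewrite (star_cofinite finA) => p _.
have Gfree : \bigcap_(A in G) A = set0.
  apply/seteqP; split=> // x /(_ (~` [set x])); apply => //.
  by apply: Gcof; rewrite setCK; exact: finite_set1.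
pose p := OmegaStar GU Gfree.
have [E pE EU] : exists2 E, star E p & star E `<=` U.
  by apply: oU; apply: FU => A FA; apply: HG; exists A => // q [].
have : star (~` E) p.
  by apply: HG; exists B0 => // q [_ nUq]; rewrite starC => /EU.
by rewrite starC.
Qed.

(** * O.K. sets are weak P-sets *)

Lemma uncountable_cantor : ~ countable [set: nat -> bool].
Proof.
move=> /countable_injP[f finj].
pose x n := `[< forall a, f a = n -> ~~ a n >].
have [xx|nxx] := boolP (x (f x)).
  by have /asboolP/(_ x erefl) := xx; rewrite xx.
move: (nxx) => /asboolP; apply => a fa.
have -> : a = x by apply: finj => //; exact: mem_set.
exact: nxx.
Qed.

(** Enumerate [D] as [d] and take neighbourhoods [star (B n)] of [X] that exclude [d k] for [k < n].
    Then [d n] lies in at most [n] of the sets [V a]. As there are uncountably many [a], some [V a]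
    misses all of [D]. *)
Lemma OK_weak_P_set (X : set omega_star) : OK_set (nat -> bool) X -> weak_P_set X.
Proof.
move=> [clX OKX] D cntD DX.
have /pfcard_geP[->|[d]] : (D #<= [set: nat])%card by [].
  by rewrite closure0 set0I.
have sep p : ~ X p -> exists A, ~ star A p /\ X `<=` star A.
  move=> Xp; have /open_omega_starP/(_ p Xp)[A pA AX] : open (~` X).
    exact: closed_openC.
  by exists (~` A); rewrite starC; split=> [//|q Xq /AX].
have /choice[A AP] n : exists A, ~ star A (d n) /\ X `<=` star A.
  by apply/sep/DX/funS.
pose B n := [set x | forall k, (k < n)%N -> A k x].
have XB n : X `<=` star (B n).
  elim: n => [|n IH] p Xp.
    by have := ultra_setsP p => ?; apply: filterS filterT => x _ k.
  suff : star (B n `&` A n) p.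
    apply: starS => x [Bx Ax] k; rewrite ltnS leq_eqVlt => /predU1P[->//|].
    exact: Bx.
  by rewrite starI; split; [exact: IH | have [_] := AP n; exact].
have [n|V VX VU] := OKX (fun n => star (B n)).
  by split; [exact: open_star | exact: XB].
have Vfin n : finite_set [set a | V a (d n)].
  apply: contrapT => /infinite_set_fset -/(_ n.+1)[E EV En].
  have [+ _] := AP n; apply.
  suff : star (B #|` E|) (d n) by apply: starS => x /(_ n En).
  apply: (VU _ [set` E]); [exact: leq_trans En | exact/card_eq_fsetP |].
  by move=> a /EV.
have [a aP] : exists a, forall n, ~ V a (d n).
  apply: contrapT => /forallNP nex; apply: uncountable_cantor.
  apply: sub_countable (bigcup_countable (countableP [set: nat])
    (fun n _ => finite_set_countable (Vfin n))).
  apply: subset_card_le => a _; have /existsNP[n /contrapT Vn] := nex a.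
  by exists n.
apply/seteqP; split=> // p [clD Xp].
have [q [/'surj_d[n _ <-] Vd]] := clD _ (VX a p Xp).
exact: (aP n).
Qed.

(** * Filters generated by a settling base *)

(** An index is a sequence of sequences of sets, hence countably many bits. This lets Kunen's
    family, indexed by the points of the Cantor space, be indexed by these sequences. *)
Definition bits (i : nat -> nat -> set nat) : nat -> bool := fun m =>
  if choice.unpickle m is Some (j, k, x) then `[< i j k x >] else false.

Lemma bits_inj : injective bits.
Proof.
move=> i i' ii'; apply/funext => j; apply/funext => k; apply/funext => x.
have := congr1 (fun f => f (choice.pickle (j, k, x))) ii'.
by rewrite /bits !choice.pickleK => e; apply/propext; split => /asboolP;
  [rewrite e | rewrite -e] => /asboolP.
Qed.

Lemma almost_subset_trans A B C :
  almost_subset A B -> almost_subset B C -> almost_subset A C.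
Proof.
move=> AB BC; have : finite_set ((A `\` B) `|` (B `\` C)).
  by rewrite finite_setU.
apply: sub_finite_set => x [Ax nCx].
by have [Bx|nBx] := pselect (B x); [right|left].
Qed.

Lemma sub_almost_subset A B : A `<=` B -> almost_subset A B.
Proof. by move=> AB; apply: sub_finite_set (@finite_set0 nat) => x [/AB]. Qed.

Definition generated_filter (G : set (set nat)) : set (set nat) :=
  [set B | exists2 l, (forall C, C \in l -> G C) & almost_subset (meet l) B].

Lemma generated_filter_sub G : G `<=` generated_filter G.
Proof.
move=> B GB; exists [:: B]; first by move=> C; rewrite inE => /eqP ->.
by apply: sub_almost_subset => x /(_ B); apply; rewrite mem_head.
Qed.

Lemma generated_filter_meet G l : (forall C, C \in l -> G C) ->
  generated_filter G (meet l).
Proof. by move=> lG; exists l => //; exact: sub_almost_subset. Qed.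

Lemma filter_on_generated S G : almost_upward_closed S ->
  (forall l, (forall B, B \in l -> G B) -> S (meet l)) ->
  filter_on_semifilter S (generated_filter G).
Proof.
move=> upS GS; split.
- by exists (meet [::]); exact: generated_filter_meet.
- by move=> B [l lG]; apply: upS; exact: GS.
- by move=> B C [l lG lB] BC; exists l => //; exact: almost_subset_trans BC.
- move=> B C [l lG lB] [l' l'G l'C]; exists (l ++ l').
    by move=> E; rewrite mem_cat => /orP[/lG|/l'G].
  have : finite_set ((meet l `\` B) `|` (meet l' `\` C)) by rewrite finite_setU.
  apply: sub_finite_set => x [xl nBC].
  have xl1 : meet l x by move=> E El; apply: xl; rewrite mem_cat El.
  have xl2 : meet l' x by move=> E El; apply: xl; rewrite mem_cat El orbT.
  by have [Bx|nBx] := pselect (B x); [right; split=> // Cx; exact: nBC | left].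
Qed.

Lemma filter_initial_meet S F t n : filter_on_semifilter S F ->
  (forall n, F (t n)) -> F (initial_meet t n).
Proof.
move=> [_ _ upF FI] Ft; elim: n => [|n IH].
  apply: upF (Ft 0%N) _; apply: sub_almost_subset => x tx k.
  by rewrite leqn0 => /eqP ->.
apply: upF (FI _ _ IH (Ft n.+1)) _; apply: sub_almost_subset => x [tx tnx] k.
by rewrite leq_eqVlt ltnS => /predU1P[->//|/tx].
Qed.

Lemma star_meet (J : eqType) (V : J -> set nat) (s : seq J) (p : omega_star) :
  (forall a, a \in s -> star (V a) p) ->
  star [set x | forall a, a \in s -> V a x] p.
Proof.
have := ultra_setsP p => ?.
elim: s => [_|a s IH sV]; first exact: filterS filterT.
have pa : star (V a) p by apply: sV; rewrite mem_head.
have ps : star [set x | forall a, a \in s -> V a x] p.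
  by apply: IH => b bs; apply: sV; rewrite in_cons bs orbT.
apply: filterS (filterI pa ps) => x [ax sx] b.
by rewrite in_cons => /predU1P[->//|]; exact: sx.
Qed.

Section settling_filter.
Variables (S G : set (set nat)).
Hypothesis S_up : almost_upward_closed S.
Hypothesis G_S : forall l, (forall B, B \in l -> G B) -> S (meet l).
Hypothesis G_settles : forall t, settles S (nat -> bool) G t.

(** A set [B] in a larger filter [H] gives a constant sequence compatible with [G] inside [S]; as
    [G] settles it, [B] is already in [G]. *)
Lemma ultrafilter_on_generated :
  ultrafilter_on_semifilter S (generated_filter G).
Proof.
split; first exact: filter_on_generated.
move=> H HS GH; apply/seteqP; split=> // B HB.
have [[l [n [lG nS]]]|[GB _]] := G_settles (fun=> B); last first.
  exact/generated_filter_sub/(GB 0%N).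
have [_ sHS _ HI] := HS; exfalso; apply/nS/sHS/HI.
  exact/GH/generated_filter_meet.
exact: filter_initial_meet HS _.
Qed.

(** By compactness each [U n] shrinks to some [star (t n)] with [t n] in the filter. Then [t] is
    compatible with [G], so settling it yields the family [V]. *)
Lemma OK_generated : OK_set (nat -> bool) (stone_dual (generated_filter G)).
Proof.
have FS := filter_on_generated S_up G_S; have [F0 sFS upF FI] := FS.
split; first exact: closed_stone_dual.
move=> U oU.
have /choice[t tP] n : exists B, generated_filter G B /\ star B `<=` U n.
  have [oUn XU] := oU n.
  by have [B FB BU] := stone_dual_compact F0 upF FI oUn XU; exists B.
have Ft n : generated_filter G (t n) by have [] := tP n.
have [[l [n [lG nS]]]|[_ [V [GV Vlink]]]] := G_settles t.
  exfalso; apply/nS/sFS/FI; first exact: generated_filter_meet.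
  exact: filter_initial_meet FS _.
exists (star \o V) => [a p Xp|n E n0 En p pV].
  apply: open_nbhs_nbhs; split; first exact: open_star.
  exact/Xp/generated_filter_sub.
have [_] := tP n; apply.
pose s : seq (nat -> bool) := fset_set E.
have finE : finite_set E by apply/finite_setP; exists n.
have sE a : a \in s -> E a by rewrite /s in_fset_set// => /set_mem.
have sz : size s = n by exact: card_fset_set.
(* The finite error in the linking of [V] is invisible to free ultrafilters. *)
have := Vlink s (fset_uniq _); rewrite sz => /(_ n0) /star_almost_subset; apply.
by apply: star_meet => a /sE; exact: pV.
Qed.

End settling_filter.

Theorem theorem5p3 (S : set (set nat)) :
  semifilter S -> comeager (in_cantor S) ->
  exists F : set (set nat),
    [/\ ultrafilter_on_semifilter S F,
        OK_set (nat -> bool) (stone_dual F) &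
        weak_P_set (stone_dual F)].
Proof.
move=> [_ _ S_up] coS.
have [b [bfin bS]] := comeager_finite_to_one S_up coS.
have [A [Amono Alinked Aindep]] :=
  independent_linked_family bits_inj S_up bfin bS.
have [G [GS Gsettles]] := settling_base S_up Amono Alinked Aindep.
exists (generated_filter G); have OK := OK_generated S_up GS Gsettles.
by split=> //; [exact: ultrafilter_on_generated | exact: OK_weak_P_set].
Qed.
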